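(* Let $(X,\Sigma_1,\mu)$ and $(Y,\Sigma_2,\nu)$ be two measure spaces with $\sigma$-finite measures. Let $\psi_1\in\Psi_X(a_1,b_1)$ and $\psi_2\in\Psi_Y(a_2,b_2)$, where $1\le a_i<b_i\le\infty$ for $i=1,2$, and let $f\in G_X(\psi_1;a_1,b_1)$ and $g\in G_Y(\psi_2;a_2,b_2)$. Suppose $a:=\max(a_1,a_2)<b:=\min(b_1,b_2)$, and put $\psi(p)=\psi_1(p)\psi_2(p)$ for $p\in(a,b)$. Then the function $z(x,y)=f(x)g(y)$ on the product space $(X\times Y,\Sigma_1\times\Sigma_2,\mu\times\nu)$ satisfies $$\|z\|_{G_{X\times Y}(\psi;a,b)}\le\|f\|_{G_X(\psi_1;a_1,b_1)}\,\|g\|_{G_Y(\psi_2;a_2,b_2)}.$$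
   Context: For a measure space $(Z,\Sigma,\zeta)$, numbers $1\le a<b\le\infty$ and a positive function $\psi$ on $(a,b)$, the space $G_Z(\psi;a,b)$ consists of all measurable $h:Z\to\mathbb{R}$ with finite norm $\|h\|_{G_Z(\psi;a,b)}=\sup_{p\in(a,b)}|h|_p/\psi(p)$, where $|h|_p=\left(\int_Z|h|^p\,d\zeta\right)^{1/p}$. $\Psi_Z(a,b)$ is the set of all positive continuous functions $\psi$ on the open interval $(a,b)$ for which there exists a measurable function $f:Z\to\mathbb{R}$ with $f\in\bigcap_{p\in(a,b)}L_p(Z)$ and $\psi(p)=|f|_p$ for all $p\in(a,b)$. *)

(* Defs.v *)
From HB Require Import structures.
From mathcomp Require Export all_boot all_order all_algebra.
From mathcomp Require Export all_classical all_reals all_analysis.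

Set Implicit Arguments.
Unset Strict Implicit.
Unset Printing Implicit Defensive.

Import Order.TTheory GRing.Theory Num.Theory.
Import numFieldNormedType.Exports.

Local Open Scope classical_set_scope.
Local Open Scope ring_scope.
Local Open Scope ereal_scope.

Section grand_lebesgue.
Context {d : measure_display} {T : measurableType d} {R : realType}.
Variable zeta : {measure set T -> \bar R}.
Implicit Types (psi : R -> R) (a b : \bar R).

Definition exponents a b : set R := [set p | a < p%:E < b].

Definition GL_norm psi a b (h : T -> R) : \bar R :=
  ereal_sup
    [set 'N[zeta]_(p%:E)[EFin \o h] * ((psi p)^-1)%:E | p in exponents a b].

Definition GL_space psi a b : set (T -> R) :=
  [set h | measurable_fun [set: T] h /\ GL_norm psi a b h < +oo].

(* A generating function is total on R, but only its values on the open
   interval (a, b) are constrained or used. *)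
Definition GL_generator a b : set (R -> R) :=
  [set psi : R -> R | [/\ (forall p, exponents a b p -> (0 < psi p)%R),
    {within exponents a b, continuous psi} &
    exists f : T -> R, [/\ measurable_fun [set: T] f,
      (forall p, exponents a b p -> f \in Lfun zeta p%:E) &
      (forall p, exponents a b p -> (psi p)%:E = 'N[zeta]_(p%:E)[EFin \o f])]]].

End grand_lebesgue.

(* Main.v *)
Require Import Defs.
From mathcomp Require Import measurable_realfun.
Import Order.TTheory GRing.Theory Num.Theory.
Import numFieldNormedType.Exports.
Local Open Scope classical_set_scope.
Local Open Scope ring_scope.
Local Open Scope ereal_scope.

(** The key identity is that the Lebesgue norms of a tensor product multiply,
    |f (x) g|_p = |f|_p |g|_p: for nonnegative functions Tonelli's theorem
    turns the integral of a product F(x) G(y) into a product of integrals, and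
    raising to a power commutes with products of nonnegative quantities
    ([ge0_integral_tensor], [Lnorm_tensor]).  Hence
    for p in the common part of the two intervals the quotient
    |f (x) g|_p / (psi1(p) psi2(p)) is exactly
    (|f|_p / psi1(p)) (|g|_p / psi2(p)), and each factor is at most the
    corresponding supremum.  The inequality, rather than an equality, comes
    from taking both suprema separately and over possibly larger intervals. *)

(** Tonelli's theorem pulls out one factor at a time.  Both integrals may be
    infinite; the convention 0 * +oo = 0 is the right one here, since a
    nonnegative function with zero integral vanishes almost everywhere. *)
Lemma ge0_integral_tensor (R : realType) (d1 d2 : measure_display)
  (X : measurableType d1) (Y : measurableType d2)
  (mu : {sigma_finite_measure set X -> \bar R})
  (nu : {sigma_finite_measure set Y -> \bar R})
  (F : X -> \bar R) (G : Y -> \bar R) :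
  measurable_fun [set: X] F -> measurable_fun [set: Y] G ->
  (forall x, 0 <= F x) -> (forall y, 0 <= G y) ->
  \int[mu \x nu]_z (F z.1 * G z.2) = \int[mu]_x F x * \int[nu]_y G y.
Proof.
move=> mF mG F0 G0.
rewrite fubini_tonelli1; last 2 first.
- by apply: emeasurable_funM; apply: measurableT_comp.
- by move=> z; exact: mule_ge0.
rewrite /fubini_F /=.
under eq_integral do rewrite ge0_integralZl//.
by rewrite ge0_integralZr// integral_ge0.
Qed.

(** The absolute value and the power split the integrand into a function of x
    times a function of y, so that the integrals multiply; the exponent 1/p
    then distributes over the two integrals, infinite or not. *)
Lemma Lnorm_tensor (R : realType) (d1 d2 : measure_display)
  (X : measurableType d1) (Y : measurableType d2)
  (mu : {sigma_finite_measure set X -> \bar R})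
  (nu : {sigma_finite_measure set Y -> \bar R})
  (p : R) (f : X -> R) (g : Y -> R) :
  measurable_fun [set: X] f -> measurable_fun [set: Y] g ->
  'N[mu \x nu]_(p%:E)[EFin \o (fun z => f z.1 * g z.2)%R] =
  'N[mu]_(p%:E)[EFin \o f] * 'N[nu]_(p%:E)[EFin \o g].
Proof.
have mpow d (T : measurableType d) (h : T -> R) : measurable_fun [set: T] h ->
    measurable_fun [set: T] (fun x => (`|h x| `^ p)%:E).
  move=> mh; apply/measurable_EFinP.
  by apply: (measurableT_comp (measurable_powR p)); exact: measurableT_comp.
have pow_ge0 (r : R) : 0 <= (`|r| `^ p)%:E by rewrite lee_fin powR_ge0.
move=> mf mg; rewrite unlock /=.
rewrite -poweRM ?integral_ge0//.
rewrite -ge0_integral_tensor//; [|exact: mpow..].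
congr (_ `^ _); apply: eq_integral => z _.
by rewrite normrM powRM// EFinM.
Qed.

Lemma exponents_max_min (R : realType) (a1 b1 a2 b2 : \bar R) :
  exponents (Order.max a1 a2) (Order.min b1 b2) `<=`
  exponents a1 b1 `&` exponents a2 b2.
Proof.
move=> p /=; rewrite /exponents /= gt_max lt_min.
by move=> /andP[/andP[-> ->] /andP[-> ->]].
Qed.

Lemma le_GL_norm d (T : measurableType d) (R : realType)
  (zeta : {measure set T -> \bar R}) (psi : R -> R) (a b : \bar R)
  (h : T -> R) (p : R) : exponents a b p ->
  'N[zeta]_(p%:E)[EFin \o h] * ((psi p)^-1)%:E <= GL_norm zeta psi a b h.
Proof. by move=> abp; apply: ereal_sup_ubound; exists p. Qed.

Theorem lemma1 (R : realType) (d1 d2 : measure_display)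
  (X : measurableType d1) (Y : measurableType d2)
  (mu : {sigma_finite_measure set X -> \bar R})
  (nu : {sigma_finite_measure set Y -> \bar R})
  (a1 b1 a2 b2 : \bar R) (psi1 psi2 : R -> R) (f : X -> R) (g : Y -> R)
  (ha1 : 1 <= a1) (hab1 : a1 < b1)
  (ha2 : 1 <= a2) (hab2 : a2 < b2)
  (hpsi1 : GL_generator mu a1 b1 psi1)
  (hpsi2 : GL_generator nu a2 b2 psi2)
  (hf : GL_space mu psi1 a1 b1 f)
  (hg : GL_space nu psi2 a2 b2 g)
  (hab : Order.max a1 a2 < Order.min b1 b2) :
  GL_norm (mu \x nu) (fun p => psi1 p * psi2 p)%R
    (Order.max a1 a2) (Order.min b1 b2) (fun xy => f xy.1 * g xy.2)%R
  <= GL_norm mu psi1 a1 b1 f * GL_norm nu psi2 a2 b2 g.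
Proof.
apply: ge_ereal_sup => _ [p /exponents_max_min[p1 p2] <-].
have [psi1_gt0 _ _] := hpsi1; have [psi2_gt0 _ _] := hpsi2.
rewrite Lnorm_tensor; [|exact: hf.1|exact: hg.1].
rewrite invfM EFinM muleACA.
have inv_ge0 (r : R) : (0 < r)%R -> 0 <= (r^-1)%:E.
  by move=> r0; rewrite lee_fin invr_ge0 ltW.
by apply: lee_pmul;
  rewrite ?le_GL_norm ?mule_ge0 ?inv_ge0 ?psi1_gt0 ?psi2_gt0 ?Lnorm_ge0.
Qed.
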